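(* For $0\le s\le t$ and $x\ge 0$, $$\bigl\|\mathbb{P}(X_s(t)\in\cdot)-\mathbb{P}(X(t)\in\cdot\mid X(0)=x)\bigr\|\le \mathbb{P}(\tilde v_t\le s\mid X(0)=x).$$
   Context: Let $B$ be a standard Brownian motion and $\mu(\cdot),\sigma(\cdot)$ measurable deterministic functions on $[0,\infty)$ (such that $\int_0^t\mu(s)\,ds$ and $\int_0^t\sigma(s)\,dB(s)$ are well defined for all $t$). $X=(X(t):t\ge0)$ is the non-stationary reflected Brownian motion solving $$dX(t)=\mu(t)\,dt+\sigma(t)\,dB(t)+dL(t),$$ where $X\geq 0$ and $L$ is the continuous non-decreasing process with $L(0)=0$ and $I(X(t)>0)\,dL(t)=0$ for $t\ge0$. For $0\le s\le t$, $(X_s(t):t\ge s)$ denotes the solution of the same equation on $[s,\infty)$ conditional on $X_s(s)=0$. Set $\tilde v_t=\sup\{r\in[0,t]:X(r)=0\}$, with the convention $\tilde v_t=-\infty$ if $X$ does not visit $0$ over $[0,t]$. The total variation norm is $\|P-Q\|=\sup_B|P(B)-Q(B)|$, the supremum over Borel sets $B$. *)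

(* Defs.v *)
From mathcomp Require Import all_boot all_order all_algebra.
From mathcomp Require Import all_classical all_reals all_analysis.

Set Implicit Arguments.
Unset Strict Implicit.
Unset Printing Implicit Defensive.

Import Order.TTheory GRing.Theory Num.Theory.
Import numFieldNormedType.Exports.

Local Open Scope classical_set_scope.
Local Open Scope ring_scope.

Section Paths.
Context {R : realType}.
Implicit Types (x l : R -> R) (s t : R).

(* The value is -oo when [x] has no zero in [0, t]. *)
Definition last_zero x t : \bar R :=
  ereal_sup [set r%:E | r in [set r | 0 <= r <= t /\ x r = 0]].

(* [F] is [l] extended to the left of [s] by the constant [l s]: the Stieltjes
   measure [dl] on [s, +oo[ is the one induced by [F], which carries the proof
   that [l] is nondecreasing.  The integral is that of I(x > 0) dl. *)
Definition regulates s x l : Prop :=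
  [/\ l s = 0,
      {within `[s, +oo[, continuous l} &
      exists F : cumulative R R,
        (forall r, F r = l (Num.max s r)) /\
        (\int[lebesgue_stieltjes_measure F]_(r in `[s, +oo[)
           (\1_[set r | 0 < x r] r)%:E = 0)%E].

(* A triple [(a, b, c)] stands for the elementary integrand c 1_]a, b]. *)
Definition step := seq (R * R * R).

Definition step_within t (phi : step) : bool :=
  all (fun p => [&& 0 <= p.1.1, p.1.1 <= p.1.2 & p.1.2 <= t]) phi.

Definition step_fun (phi : step) (u : R) : R :=
  \sum_(p <- phi) p.2 * \1_`]p.1.1, p.1.2] u.

Definition step_int (b : R -> R) (phi : step) : R :=
  \sum_(p <- phi) p.2 * (b p.1.2 - b p.1.1).

Definition halfline_loc_integrable (f : R -> R) : Prop :=
  forall t, 0 <= t -> lebesgue_measure.-integrable `[0, t] (EFin \o f).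

Definition tv_dist d (T : measurableType d) (p q : set T -> \bar R) : \bar R :=
  ereal_sup [set `|p A - q A|%E | A in measurable].

End Paths.

Section Processes.
Context {d : measure_display} {T : measurableType d} {R : realType}.
Variable P : probability T R.
Implicit Types (B N X L : R -> {RV P >-> R}) (mu sigma : R -> R).

(* Processes are indexed by the whole of [R], their values at negative times
   being irrelevant.  The second argument of [normal_prob] is the standard
   deviation. *)
Definition standard_brownian_motion B : Prop :=
  [/\ {ae P, forall w, B 0 w = 0},
      {ae P, forall w, {within `[0, +oo[, continuous (fun t => B t w)}},
      (forall s t (A : set R), 0 <= s -> s < t -> measurable A ->
         P [set w | A (B t w - B s w)] = normal_prob 0 (Num.sqrt (t - s)) A) &
      (forall (n : nat) (t : nat -> R) (A : nat -> set R),
         0 <= t 0%N -> (forall i, t i <= t i.+1) ->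
         (forall i, measurable (A i)) ->
         P [set w | forall i, (i < n)%N -> A i (B (t i.+1) w - B (t i) w)] =
         (\prod_(i < n)
            fine (P [set w | A i (B (t i.+1) w - B (t i) w)]))%:E)].

(* [Y] is the integral of [sigma] against [B] over [0, t]: the L2(P) limit of
   the integrals of step functions which converge to [sigma] in L2([0, t]). *)
Definition is_wiener_integral B sigma t (Y : {RV P >-> R}) : Prop :=
  exists phi : nat -> step,
    [/\ forall n, step_within t (phi n),
        (\int[lebesgue_measure]_(u in `[0%R, t])
           ((step_fun (phi n) u - sigma u) ^+ 2)%:E)%E @[n --> \oo] --> 0%E &
        ('E_P[fun w => ((step_int (fun r => B r w) (phi n) - Y w) ^+ 2)%R])%E
          @[n --> \oo] --> 0%E].

(* The process of integrals, as usual in a version with continuous paths; it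
   is unique up to indistinguishability. *)
Definition wiener_integral_process B sigma N : Prop :=
  (forall t, 0 <= t -> is_wiener_integral B sigma t (N t)) /\
  {ae P, forall w, {within `[0, +oo[, continuous (fun t => N t w)}}.

(* The reflected equation dX = mu dt + dN + dL on [s, +oo[ with X(s) = y, for
   [N] the process of the integrals of [sigma] against [B].  The paths of [X]
   are continuous for every [w], not just almost every one, so that the event
   [last_zero (X^~ w) t <= s] is measurable even when [P] is not complete. *)
Definition reflected_solution mu N s y X : Prop :=
  (forall w, {within `[s, +oo[, continuous (fun t => X t w)}) /\
  exists L, {ae P, forall w,
    [/\ X s w = y,
        regulates s (fun t => X t w) (fun t => L t w) &
        forall t, s <= t -> 0 <= X t w /\
          X t w = X s w + \int[lebesgue_measure]_(u in `[s, t]) mu u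
                  + (N t w - N s w) + L t w]}.

End Processes.

(* Main.v *)
(* Synchronous coupling: [X] and [Xs] are driven by the same noise.  While one
   reflected path lies strictly above another it is positive, so its regulator
   is frozen and the gap cannot widen; hence reflected paths preserve their
   order.  Since [Xs] starts from 0 it stays below [X], so it also vanishes at
   any zero [r > s] of [X], and from [r] on both paths coincide.  Thus
   [X t <> Xs t] forces the last zero of [X] before [t] to be at most [s], and
   the coupling inequality concludes. *)
Require Import Defs.
From mathcomp Require Import all_boot all_order all_algebra.
From mathcomp Require Import all_classical all_reals all_analysis.
From mathcomp Require Import measurable_realfun ring lra.

Set Implicit Arguments.
Unset Strict Implicit.
Unset Printing Implicit Defensive.

Import Order.TTheory GRing.Theory Num.Theory.
Import numFieldNormedType.Exports.

Local Open Scope classical_set_scope.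
Local Open Scope ring_scope.

Lemma within_continuous_dist (R : realType) (D : set R) (f : R -> R) (r e : R) :
  {within D, continuous f} -> D r -> 0 < e ->
  exists2 d, 0 < d & forall u, D u -> `|u - r| < d -> `|f u - f r| < e.
Proof.
move=> /subspace_continuousP cf Dr e0.
have /cvgrPdist_lt/(_ e e0) := cf _ Dr.
rewrite /within /= => /nbhs_ballP[d /= d0 hd].
exists d => // u Du ur; rewrite distrC; apply: hd => //.
by rewrite /ball /= distrC.
Qed.

(** The witness is the supremum of the times in [[a, b]] where [f] is nonnegative. Applied to the
    gap of two paths, it isolates the final stretch on which their order is reversed. *)
Lemma last_nonneg (R : realType) (f : R -> R) (a b : R) :
  a <= b -> {within `[a, b], continuous f} -> 0 <= f a -> f b < 0 ->
  exists q, [/\ a <= q, q < b, 0 <= f q & forall u, q < u <= b -> f u < 0].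
Proof.
move=> ab cf fa fb.
pose A := [set u | a <= u <= b /\ 0 <= f u].
have Aa : A a by split; rewrite ?lexx ?ab.
have ubA : ubound A b by move=> u [/andP[]].
have supA : has_sup A by split; [exists a | exists b].
have aq : a <= sup A by exact: sup_upper_bound.
have qb : sup A <= b by apply: ge_sup => //; exists a.
have fq : 0 <= f (sup A).
  rewrite leNgt; apply/negP => fq.
  have qab : `[a, b]%classic (sup A) by rewrite /= in_itv/= aq.
  (* With tolerance [- f (sup A)], continuity makes [f] negative near [sup A], where points of [A]
     accumulate. *)
  have fq0 : 0 < - f (sup A) by rewrite oppr_gt0.
  have [d d0 hd] := within_continuous_dist cf qab fq0.
  have [u Au ud] := sup_adherent d0 supA.
  have uq : u <= sup A by exact: sup_upper_bound.
  have : `|f u - f (sup A)| < - f (sup A).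
    apply: hd; first by case: Au; rewrite /= in_itv.
    by rewrite ler0_norm ?subr_le0// opprB ltrBlDr -ltrBlDl.
  rewrite ltr_norml => /andP[_]; rewrite ltrBlDr addNr.
  by rewrite ltNge; case: Au => _ ->.
exists (sup A); split => //.
  by rewrite lt_neqAle qb andbT; apply: contraTneq fb => <-; rewrite -leNgt.
move=> u /andP[qu ub]; rewrite ltNge; apply/negP => fu.
move: (qu); rewrite ltNge sup_upper_bound//; split => //.
by rewrite ub andbT (le_trans aq)// ltW.
Qed.

Lemma regulates_nondecreasing (R : realType) (s : R) (x l : R -> R) (q u : R) :
  regulates s x l -> s <= q -> q <= u -> l q <= l u.
Proof.
move=> [_ _ [F [Fl _]]] sq qu.
have := cumulative_is_nondecreasing F; move=> /(_ _ _ qu).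
by rewrite !Fl !max_r// (le_trans sq).
Qed.

(** The measure [dl] does not charge the times where [x] is positive, and []q, u]] consists of such
    times. The interval is open at [q], where the path may well be at 0. *)
Lemma regulates_flat (R : realType) (s : R) (x l : R -> R) (q u : R) :
  {within `[s, +oo[, continuous x} -> regulates s x l ->
  s <= q -> q <= u -> (forall r, q < r <= u -> 0 < x r) -> l q = l u.
Proof.
move=> cx rl sq qu xpos; apply/le_anti; rewrite (regulates_nondecreasing rl)//=.
have [_ _ [F [Fl F0]]] := rl.
(* [x] is controlled only on [[s, +oo[], so measurability is claimed for the trace there, which has
   the same integral over [[s, +oo[]. *)
have mxs : measurable (`[s, +oo[ `&` [set r | 0 < x r]).
  have mx : measurable_fun `[s, +oo[ x.
    exact: subspace_continuous_measurable_fun.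
  have := mx (measurable_itv _) _ (measurable_itv `]0, +oo[).
  congr measurable; apply/seteqP; split => r /=; rewrite !in_itv/= ?andbT; tauto.
have mF : lebesgue_stieltjes_measure F `]q, u] = (l u - l q)%:E.
  rewrite /lebesgue_stieltjes_measure /measure_extension/=.
  rewrite measurable_mu_extE/= ?wlength_itv_bnd//; last exact: is_ocitv.
  by rewrite !Fl !max_r// (le_trans sq).
rewrite -subr_le0 -lee_fin -mF -[leRHS]F0.
have -> : (\int[lebesgue_stieltjes_measure F]_(r in `[s, +oo[)
    (\1_[set r | 0 < x r] r)%:E =
  \int[lebesgue_stieltjes_measure F]_(r in `[s, +oo[)
    (\1_(`[s, +oo[ `&` [set r | 0 < x r]) r)%:E)%E.
  apply: eq_integral => r; rewrite inE => sr; rewrite !indicE; congr (_%:R%:E).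
  by rewrite in_setI (mem_set sr).
rewrite integral_indic//; apply: le_measure; rewrite ?inE//.
  exact: measurableI.
move=> r /=; rewrite !in_itv/= andbT => /andP[qr ru].
have sr : s <= r by apply: ltW; apply: le_lt_trans qr.
by split=> //; split=> //; apply: xpos; rewrite qr.
Qed.

(** After the last time [q] with [x1 <= x2], [x1] is positive, so [l1] is frozen while [l2] can only
    grow; [y] cancels in the gap, which is thus at least as large at [b] as at [q]. Separate
    starting times and constants allow paths started at different times. *)
Lemma reflected_paths_le (R : realType) (s1 s2 a b c1 c2 : R)
    (x1 x2 l1 l2 y : R -> R) :
  {within `[s1, +oo[, continuous x1} -> {within `[s2, +oo[, continuous x2} ->
  regulates s1 x1 l1 -> regulates s2 x2 l2 ->
  s1 <= a -> s2 <= a -> a <= b ->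
  (forall u, a <= u -> x1 u = c1 + y u + l1 u) ->
  (forall u, a <= u -> x2 u = c2 + y u + l2 u) ->
  (forall u, a <= u -> 0 <= x2 u) ->
  x1 a <= x2 a -> x1 b <= x2 b.
Proof.
move=> cx1 cx2 rl1 rl2 sa1 sa2 ab e1 e2 x2ge0 xa; rewrite leNgt.
apply/negP => xb.
have cD : {within `[a, b], continuous (x2 \- x1)}.
  have sub s : s <= a -> `[a, b] `<=` `[s, +oo[.
    move=> sa r /=; rewrite !in_itv/= andbT => /andP[ar _].
    exact: le_trans ar.
  move=> r; apply: (@continuousB _ _ (subspace `[a, b])).
    exact: (continuous_subspaceW (sub _ sa2) cx2).
  exact: (continuous_subspaceW (sub _ sa1) cx1).
have [||q [aq qb Dq Dneg]] := last_nonneg ab cD; rewrite /= ?subr_ge0 ?subr_lt0//.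
have l1E : l1 q = l1 b.
  apply: (regulates_flat cx1 rl1) => [||r /[dup] qrb /andP[qr rb]].
  - exact: le_trans aq.
  - exact: ltW.
  - have := Dneg _ qrb; rewrite /= subr_lt0; apply: le_lt_trans.
    by apply: x2ge0; rewrite (le_trans aq)// ltW.
have l2le : l2 q <= l2 b.
  by apply: (regulates_nondecreasing rl2); [exact: le_trans aq|exact: ltW].
move: Dq xb; rewrite /= !e1 ?e2// l1E; lra.
Qed.

(* By compactness, a continuous path vanishes on [a, b] iff it takes arbitrarily
   small values there, and rational times clamped to [a, b] are enough. *)
Lemma measurable_zero_segment (d : measure_display) (T : measurableType d)
    (R : realType) (X : R -> {mfun T >-> R}) (a b : R) :
  (forall w, {within `[a, b], continuous (fun r => X r w)}) ->
  measurable [set w | exists2 r, r \in `[a, b] & X r w = 0].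
Proof.
move=> cX; have [ba|ab] := ltP b a.
  rewrite (_ : [set _ | _] = set0)//; apply/seteqP; split => // w [r].
  by rewrite in_itv/= => /andP[ar rb]; move: (le_trans ar rb); rewrite leNgt ba.
pose clamp (v : R) := Num.max a (Num.min b v).
have clamp_in v : clamp v \in `[a, b].
  by rewrite in_itv/= /clamp le_max lexx/= ge_max ab ge_min lexx.
rewrite (_ : [set _ | _] =
    \bigcap_k \bigcup_(q : rat) X (clamp (ratr q)) @^-1` ball 0 k.+1%:R^-1).
  apply: bigcapT_measurable => k; apply: bigcupT_measurable_rat => q.
  by apply: measurable_funPTI; exact: measurable_ball.
apply/seteqP; split => w /=.
  move=> [r rab Xr] k _.
  have k0 : 0 < k.+1%:R^-1 :> R by rewrite invr_gt0.
  have [e e0 he] := within_continuous_dist (cX w) rab k0.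
  have [q] : exists q, ratr q \in `]r - e, r + e[ by apply: rat_in_itvoo; lra.
  rewrite in_itv/= => /andP[qr rq]; exists q => //=.
  rewrite /ball/= sub0r normrN.
  have := he (clamp (ratr q)) (clamp_in _); rewrite Xr subr0; apply.
  (* Clamping fixes [r], so it does not take the rational further from [r]. *)
  move: rab; rewrite in_itv/= => /andP[ar rb].
  rewrite ltr_distl /clamp lt_max lt_min gt_max gt_min qr rq !orbT andbT.
  by apply/andP; split; [apply/orP; right; lra|lra].
move=> Xw; have cnX : {within `[a, b], continuous (fun r => `|X r w|)}.
  by move=> r; apply: continuous_comp; [exact: cX|exact: norm_continuous].
have [c cab cmin] := EVT_min ab cnX.
exists c => //; apply/eqP/negPn/negP; rewrite -normr_gt0 => c0.
(* A positive minimum of the absolute value would exceed some [k.+1%:R^-1], yet a clamped rational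
   time gives a smaller value. *)
have [k] := ltr_add_invr c0; rewrite add0r => kc.
have [q _] := Xw k I; rewrite /ball/= sub0r normrN => qk.
by have := le_lt_trans (cmin _ (clamp_in _)) (lt_trans qk kc); rewrite ltxx.
Qed.

(** The complement says that there is a zero in []s, t]], an interval exhausted by countably many
    closed segments, to which the compactness argument applies. *)
Lemma measurable_last_zero_le (d : measure_display) (T : measurableType d)
    (R : realType) (X : R -> {mfun T >-> R}) (s t : R) :
  0 <= s -> (forall w, {within `[0, +oo[, continuous (fun r => X r w)}) ->
  measurable [set w | (last_zero (fun r => X r w) t <= s%:E)%E].
Proof.
move=> s0 cX.
rewrite (_ : [set _ | _] = ~` \bigcup_k
    [set w | exists2 r, r \in `[s + k.+1%:R^-1, t] & X r w = 0]).
  apply/measurableC/bigcupT_measurable => k.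
  apply: measurable_zero_segment => w; apply: continuous_subspaceW (cX w).
  move=> r /=; rewrite !in_itv/= andbT => /andP[+ _]; apply: le_trans.
  by rewrite addr_ge0// invr_ge0.
apply/seteqP; split => w /=.
  move=> zs [k _ [r]]; rewrite in_itv/= => /andP[skr rt] Xr.
  have sr : s < r by apply: lt_le_trans skr; rewrite ltrDl invr_gt0.
  have : (r%:E <= s%:E)%E.
    apply: le_trans zs; apply: ereal_sup_ubound; exists r => //=; split => //.
    by rewrite rt (le_trans s0)// ltW.
  by rewrite lee_fin leNgt sr.
move=> nz; apply: ge_ereal_sup => _ [r [/andP[r0 rt] Xr] <-].
rewrite lee_fin leNgt; apply/negP => sr; apply: nz.
have [k skr] := ltr_add_invr sr.
by exists k => //; exists r => //; rewrite in_itv/= rt ltW.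
Qed.

(** For each [A], the events that [X] and that [Y] lies in [A] differ only inside [E], up to a null
    set. *)
Lemma tv_dist_coupling (d d' : measure_display) (T : measurableType d)
    (T' : measurableType d') (R : realType) (P : probability T R)
    (X Y : {RV P >-> T'}) (E : set T) :
  measurable E -> {ae P, forall w, ~ E w -> X w = Y w} ->
  (tv_dist (distribution P X) (distribution P Y) <= P E)%E.
Proof.
(* The exceptional set need not be measurable; [Z] is a measurable null set that covers it. *)
move=> mE [Z [mZ PZ XYZ]].
have EZ U V : measurable U -> measurable V -> U `<=` V `|` (E `|` Z) ->
    (P U <= P V + P E)%E.
  move=> mU mV UV; apply: (@le_trans _ _ (P (V `|` (E `|` Z)))).
    by apply: le_measure; rewrite ?inE//; do 2?apply: measurableU.
  apply: le_trans (measureU2 _ mV (measurableU _ _ mE mZ)) _; apply: leeD2l.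
  by rewrite -[leRHS]adde0 -PZ; exact: measureU2.
have XY w : X w = Y w \/ (E `|` Z) w.
  have [Ew|nEw] := pselect (E w); first by right; left.
  have [Zw|nZw] := pselect (Z w); first by right; right.
  by left; apply: contrapT => XYw; apply/nZw/XYZ => /(_ nEw).
apply: ge_ereal_sup => _ [A mA <-]; rewrite /distribution/= /pushforward.
have mXA : measurable (X @^-1` A) by exact: measurable_funPTI.
have mYA : measurable (Y @^-1` A) by exact: measurable_funPTI.
have leXY : (P (X @^-1` A) <= P (Y @^-1` A) + P E)%E.
  apply: EZ => // w Aw; have [XYw|] := XY w; last by right.
  by left; rewrite /preimage/= -XYw.
have leYX : (P (Y @^-1` A) <= P (X @^-1` A) + P E)%E.
  apply: EZ => // w Aw; have [XYw|] := XY w; last by right.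
  by left; rewrite /preimage/= XYw.
move: leXY leYX.
have fin U : measurable U -> exists p, P U = p%:E.
  by move=> mU; exists (fine (P U)); rewrite fineK// fin_num_measure.
have [p ->] := fin _ mXA; have [q ->] := fin _ mYA; have [e ->] := fin _ mE.
by rewrite -!EFinD !lee_fin ler_distl => pq qp; apply/andP; split; lra.
Qed.

Theorem proposition2p1 (R : realType) (d : measure_display)
  (T : measurableType d) (P : probability T R)
  (B N : R -> {RV P >-> R}) (mu sigma : R -> R)
  (X Xs : R -> {RV P >-> R}) (s t x : R)
  (hB : standard_brownian_motion B)
  (mmu : measurable_fun `[0 : R, +oo[ mu)
  (msigma : measurable_fun `[0 : R, +oo[ sigma)
  (imu : halfline_loc_integrable mu)
  (isigma : halfline_loc_integrable (fun u => sigma u ^+ 2))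
  (hN : wiener_integral_process B sigma N)
  (hs : 0 <= s) (hst : s <= t) (hx : 0 <= x)
  (hX : reflected_solution mu N 0 x X)
  (hXs : reflected_solution mu N s 0 Xs) :
  (tv_dist (distribution P (Xs t)) (distribution P (X t)) <=
   P [set w | last_zero (fun r => X r w) t <= s%:E])%E.
Proof.
have [cX [L hL]] := hX; have [cXs [Ls hLs]] := hXs.
have mE := measurable_last_zero_le t hs cX.
apply: tv_dist_coupling mE _.
(* Off the event, some zero [r] of [X] lies in []s, t]]; any such zero serves, not only the last. *)
move: hL hLs; apply: filterS2 => w [X0 rL eX] [Xs0 rLs eXs] /negP.
rewrite -ltNge => /ereal_sup_gt[_ [r [/andP[r0 rt] Xr] <-]]; rewrite lte_fin => sr.
(* [y] is the common driver counted from time 0; the different starting data go into the additive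
   constants, [- N 0 w] included. *)
pose y u := \int[lebesgue_measure]_(v in `[0, u]) mu v + N u w.
have yX u : s <= u -> X u w = (x - N 0 w) + y u + L u w.
  move=> su; have [_ ->] := eX u (le_trans hs su).
  by rewrite X0 /y; ring.
have yXs u : s <= u -> Xs u w = (- y s) + y u + Ls u w.
  move=> su; have [_ ->] := eXs u su; rewrite Xs0 /y.
  (* The difference is an integral over []s, u]]; adding the endpoint [s] changes nothing for
     Lebesgue measure. *)
  have -> : \int[lebesgue_measure]_(v in `[s, u]) mu v =
      \int[lebesgue_measure]_(v in `[0, u]) mu v -
      \int[lebesgue_measure]_(v in `[0, s]) mu v.
    rewrite Rintegral_itvB//; last exact: imu (le_trans hs su).
    rewrite Rintegral_itv_obnd_cbnd//.
    apply: integrableS (imu _ (le_trans hs su)) => //.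
    by apply: subset_itvr; rewrite bnd_simp.
  ring.
have X_ge0 u : s <= u -> 0 <= X u w.
  by move=> su; have [] := eX u (le_trans hs su).
have Xs_ge0 u : s <= u -> 0 <= Xs u w by move=> su; have [] := eXs u su.
have sr' := ltW sr.
have tail (Q : R -> Prop) : (forall u, s <= u -> Q u) -> forall u, r <= u -> Q u.
  by move=> h u ru; apply: h; apply: le_trans ru.
have XsX : Xs r w <= X r w.
  apply: (reflected_paths_le (cXs w) (cX w) rLs rL _ _ _ yXs yX X_ge0) => //.
  by rewrite Xs0 X_ge0.
have Xsr : Xs r w = 0 by apply/le_anti; rewrite -{1}Xr XsX Xs_ge0.
(* Both paths vanish at [r], so the comparison restarted at [r] applies in both directions. *)
apply/le_anti/andP; split.
  apply: (reflected_paths_le (cXs w) (cX w) rLs rL _ _ rt (tail _ yXs)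
    (tail _ yX) (tail _ X_ge0)) => //.
apply: (reflected_paths_le (cX w) (cXs w) rL rLs _ _ rt (tail _ yX)
  (tail _ yXs) (tail _ Xs_ge0)) => //.
by rewrite Xr Xsr.
Qed.
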